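(* Let $G$ be a finite group, $K\le G$ a subgroup, $(\sigma,W)$ a representation of $G$ and $(\theta,V)$ a representation of $K$. For every $T\in\mathrm{Hom}_G(\mathrm{Ind}_K^GV,W)$ we have $T^\circ\in\mathrm{Hom}_K(V,\mathrm{Res}^G_KW)$, and the map $$\mathrm{Hom}_G(\mathrm{Ind}_K^GV,W)\longrightarrow\mathrm{Hom}_K(V,\mathrm{Res}^G_KW),\qquad T\longmapsto T^\circ,$$ is a linear isomorphism with $$\langle T_1^\circ,T_2^\circ\rangle=|G/K|\,\langle T_1,T_2\rangle\qquad\text{for all }T_1,T_2\in\mathrm{Hom}_G(\mathrm{Ind}_K^GV,W).$$ Its inverse is the map $\mathrm{Hom}_K(V,\mathrm{Res}^G_KW)\to\mathrm{Hom}_G(\mathrm{Ind}_K^GV,W)$, $L\mapsto L^\diamond$, and $$(L^* )^\vee=(L^\diamond)^*\qquad\text{for all }L\in\mathrm{Hom}_K(V,\mathrm{Res}^G_KW).$$ In particular, the square formed by $\wedge:\mathrm{Hom}_G(W,\mathrm{Ind}_K^GV)\to\mathrm{Hom}_K(\mathrm{Res}^G_KW,V)$, $\circ:\mathrm{Hom}_G(\mathrm{Ind}_K^GV,W)\to\mathrm{Hom}_K(V,\mathrm{Res}^G_KW)$ and the two adjoint maps $*:\mathrm{Hom}_G(W,\mathrm{Ind}_K^GV)\to\mathrm{Hom}_G(\mathrm{Ind}_K^GV,W)$ and $*:\mathrm{Hom}_K(\mathrm{Res}^G_KW,V)\to\mathrm{Hom}_K(V,\mathrm{Res}^G_KW)$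 is commutative, i.e. $(T^* )^\circ=(T^\wedge)^*$ for all $T\in\mathrm{Hom}_G(W,\mathrm{Ind}_K^GV)$.
   Context: All vector spaces are finite-dimensional complex vector spaces with a Hermitian scalar product (linear in the first argument); all representations of finite groups are unitary. $T^*$ denotes the adjoint of $T$. For spaces $A,B$, $\mathrm{Hom}(A,B)$ (and every subspace of it) carries the normalized Hilbert–Schmidt scalar product $\langle T_1,T_2\rangle=\frac{1}{\dim A}\mathrm{tr}(T_2^*T_1)$. $\mathrm{Hom}_G(A,B)$ (resp. $\mathrm{Hom}_K$) is the space of linear maps intertwining the $G$- (resp. $K$-) actions. Induced representation: $\mathrm{Ind}_K^GV=\{f:G\to V: f(gk)=\theta(k^{-1})f(g)\ \forall g\in G,k\in K\}$ with $G$-action $[\lambda(g_0)f](g)=f(g_0^{-1}g)$ and scalar product $\langle f_1,f_2\rangle=\frac1{|K|}\sum_{g\in G}\langle f_1(g),f_2(g)\rangle_V$. For $v\in V$, $f_v\in \mathrm{Ind}_K^GV$ is defined by $f_v(g)=\theta(g^{-1})v$ if $g\in K$ and $f_v(g)=0$ if $g\notin K$. $\mathcal T$ is a set of representatives of the cosets $tK$, so $G=\coprod_{t\in\mathcal T}tK$. Maps: for $T\in\mathrm{Hom}_G(W,\mathrm{Ind}_K^GV)$, $T^\wedge w=\sqrt{|G/K|}\,[Tw](1_G)$. For $L\in\mathrm{Hom}_K(\mathrm{Res}^G_KW,V)$, $[L^\vee w](g)=\frac{1}{\sqrt{|G/K|}}L\sigma(g^{-1})w$. For $T\in\mathrm{Hom}_G(\mathrm{Ind}_K^GV,W)$,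 $T^\circ v=\sqrt{|G/K|}\,Tf_v$. For $L\in\mathrm{Hom}_K(V,\mathrm{Res}^G_KW)$, $L^\diamond f=\frac{1}{\sqrt{|G/K|}}\sum_{t\in\mathcal T}\sigma(t)Lf(t)=\frac{1}{\sqrt{|G||K|}}\sum_{g\in G}\sigma(g)Lf(g)$ for $f\in\mathrm{Ind}_K^GV$ (independent of the choice of $\mathcal T$). *)

(* Defs.v *)
From HB Require Import structures.
From mathcomp Require Import all_boot all_order all_algebra all_fingroup.
From mathcomp Require Import sesquilinear.

Set Implicit Arguments.
Unset Strict Implicit.
Unset Printing Implicit Defensive.

Import GRing.Theory Num.Theory Num.Def.
Import passmx.
Local Open Scope ring_scope.

(* A {dot V for conjC} is linear in its first argument, conjugate-linear in
   its second one. *)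
HB.mixin Record hasHermDot (C : numClosedFieldType) V of Vector C V := {
  hdot : {dot V for (@conjC C)} }.

#[short(type="hermType")]
HB.structure Definition HermSpace (C : numClosedFieldType) :=
  {V of hasHermDot C V & Vector C V}.

Definition dotp (C : numClosedFieldType) (V : hermType C) (u v : V) : C :=
  hdot u v.

Notation "''[' u , v ]" := (dotp u%R v%R) : ring_scope.

Section DotTheory.
Variables (C : numClosedFieldType) (V : hermType C).
Implicit Types (u v w : V) (a : C).

Lemma dotpPl a u v w : '[a *: u + v, w] = a * '[u, w] + '[v, w].
Proof. exact: linearPl. Qed.
Lemma dotpPr a u v w : '[w, a *: u + v] = a^* * '[w, u] + '[w, v].
Proof. exact: linearPr. Qed.
Lemma dotpZl a u v : '[a *: u, v] = a * '[u, v].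
Proof. exact: linearZl_LR. Qed.
Lemma dotpZr a u v : '[u, a *: v] = a^* * '[u, v].
Proof. exact: linearZr_LR. Qed.
Lemma dotp_suml I r (P : pred I) (F : I -> V) u :
  '[\sum_(i <- r | P i) F i, u] = \sum_(i <- r | P i) '[F i, u].
Proof. exact: linear_sumlz. Qed.
Lemma dotp_sumr I r (P : pred I) (F : I -> V) u :
  '[u, \sum_(i <- r | P i) F i] = \sum_(i <- r | P i) '[u, F i].
Proof. exact: linear_sumr. Qed.
Lemma dotpBr u v w : '[w, u - v] = '[w, u] - '[w, v].
Proof. exact: linearBr. Qed.
Lemma dotpC u v : '[u, v] = ('[v, u])^*.
Proof. by rewrite /dotp hermC expr0 mul1r. Qed.
Lemma dotp_eq0 u : ('[u, u] == 0) = (u == 0).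
Proof. exact: dnorm_eq0. Qed.
Lemma dotp_ge0 u : 0 <= '[u, u].
Proof. exact: dnorm_ge0. Qed.
Lemma dotp_gt0 u : (0 < '[u, u]) = (u != 0).
Proof. exact: dnorm_gt0. Qed.
End DotTheory.

Section Linear.
Variables (F : fieldType) (U1 U2 : vectType F).

Definition linear_iso (E1 : {vspace U1}) (E2 : {vspace U2}) (f : U1 -> U2) :=
  [/\ {in E1, forall x, f x \in E2},
      {in E1 &, forall x y, forall a, f (a *: x + y) = a *: f x + f y},
      {in E1 &, injective f}
    & {in E2, forall y, exists2 x, x \in E1 & f x = y}].

(* Independent of the basis, by lfun_trE. *)
Definition lfun_tr (f : 'End(U1)) : F :=
  \tr (mxof (vbasis {:U1}) (vbasis {:U1}) f).

Lemma lfun_trE (e : (\dim {:U1}).-tuple U1) (f : 'End(U1)) :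
  basis_of {:U1} e -> lfun_tr f = \tr (mxof e e f).
Proof.
rewrite /lfun_tr => eb; set v := vbasis _.
have vb : basis_of {:U1} v by exact: vbasisP.
have -> : mxof v v f = mxof v e \1%VF *m mxof e e f *m mxof e v \1%VF.
  by rewrite -!mxof_comp // comp_lfun1l comp_lfun1r.
rewrite mxtrace_mulC mulmxA -mxof_comp // comp_lfun1l mxof1 ?mul1mx //.
exact: basis_free eb.
Qed.
End Linear.

Section Adjoint.
Variables (C : numClosedFieldType) (A B : hermType C).
Local Notation n := (\dim {:A}).
Local Notation e := (vbasis {:A}).

Definition gram : 'M[C]_n := \matrix_(i < n, j < n) '[e`_i, e`_j].

(* The coordinates c of the adjoint's value at b solve
   '[b, T e_i] = \sum_k c_k '[e_k, e_i] for all i. *)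
Definition lfun_adj_fun (T : 'Hom(A, B)) (b : B) : A :=
  vecof e ((\row_(i < n) '[b, T e`_i]) *m invmx gram).

Fact lfun_adj_linear T : linear (lfun_adj_fun T).
Proof.
move=> a x y; rewrite /lfun_adj_fun -linearP; congr vecof.
rewrite scalemxAl -mulmxDl; congr (_ *m _).
by apply/rowP=> i; rewrite !mxE dotpPl.
Qed.
HB.instance Definition _ T := GRing.isSemilinear.Build C B A _ (lfun_adj_fun T)
  (GRing.semilinear_linear (lfun_adj_linear T)).

Definition lfun_adj (T : 'Hom(A, B)) : 'Hom(B, A) := linfun (lfun_adj_fun T).

Lemma dotp_vecof (u : 'rV_n) (j : 'I_n) : '[vecof e u, e`_j] = (u *m gram) 0 j.
Proof.
rewrite /vecof dotp_suml mxE; apply: eq_bigr => i _.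
by rewrite dotpZl mxE.
Qed.

Lemma gram_unit : gram \in unitmx.
Proof.
rewrite -row_free_unit -kermx_eq0; apply/eqP/row_matrixP=> k.
rewrite row0; set u := row k _.
have uG : u *m gram = 0 by rewrite /u -row_mul mulmx_ker row0.
have eb : basis_of {:A} e by exact: vbasisP.
suff : vecof e u == 0 by rewrite vecof_eq0// => /eqP.
rewrite -dotp_eq0; apply/eqP.
rewrite {2}/vecof dotp_sumr big1 // => j _.
by rewrite dotpZr dotp_vecof uG [X in _ * X]mxE mulr0.
Qed.

Lemma lfun_adjP (T : 'Hom(A, B)) a b : '[T a, b] = '[a, lfun_adj T b].
Proof.
rewrite (coord_vbasis (memvf a)) linear_sum !dotp_suml.
apply: eq_bigr => i _; rewrite linearZ !dotpZl; congr (_ * _).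
rewrite dotpC [RHS]dotpC lfunE /= dotp_vecof mulmxKV ?gram_unit //.
by rewrite mxE.
Qed.

Lemma lfun_adj_uniq (T : 'Hom(A, B)) (S : 'Hom(B, A)) :
  (forall a b, '[T a, b] = '[a, S b]) -> S = lfun_adj T.
Proof.
move=> TS; apply/lfunP=> b; apply/eqP; rewrite -subr_eq0 -dotp_eq0.
by rewrite dotpBr -TS lfun_adjP subrr.
Qed.
End Adjoint.

(* When A = 0 the factor is 0^-1 = 0, and the trace is 0 too. *)
Definition hs_dot (C : numClosedFieldType) (A B : hermType C)
    (T1 T2 : 'Hom(A, B)) : C :=
  (\dim {:A})%:R^-1 * lfun_tr (lfun_adj T2 \o T1)%VF.

(* As for mx_representation, the values outside G are irrelevant. *)
Record urep (C : numClosedFieldType) (gT : finGroupType) (G : {group gT})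
    (V : hermType C) := URep {
  urep_fun :> gT -> 'End(V);
  urep1 : urep_fun 1%g = \1%VF;
  urepM : {in G &, forall g h,
             urep_fun (g * h)%g = (urep_fun g \o urep_fun h)%VF};
  urep_unitary : {in G, forall g u v, '[urep_fun g u, urep_fun g v] = '[u, v]}
}.

Section Intertwiners.
Variables (C : numClosedFieldType) (gT : finGroupType) (G : {group gT}).
Variables (A B : hermType C) (sA : urep G A) (sB : urep G B).

Definition hom_defect g (T : 'Hom(A, B)) : 'Hom(A, B) :=
  (T \o sA g)%VF - (sB g \o T)%VF.

Fact hom_defect_linear g : linear (hom_defect g).
Proof.
move=> a S T; rewrite /hom_defect comp_lfunDl comp_lfunDr -comp_lfunZl.
by rewrite -comp_lfunZr scalerBr opprD addrACA.
Qed.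
HB.instance Definition _ g := GRing.isSemilinear.Build C 'Hom(A, B) 'Hom(A, B)
  _ (hom_defect g) (GRing.semilinear_linear (hom_defect_linear g)).

Definition hom_rep : {vspace 'Hom(A, B)} :=
  (\bigcap_(g in G) lker (linfun (hom_defect g)))%VS.

Lemma hom_repP (T : 'Hom(A, B)) :
  reflect {in G, forall g, (T \o sA g)%VF = (sB g \o T)%VF} (T \in hom_rep).
Proof.
rewrite memvE; apply: (iffP subv_bigcapP) => H g Gg.
  by have := H g Gg; rewrite -memvE memv_ker lfunE /= subr_eq0 => /eqP.
by rewrite -memvE memv_ker lfunE /= /hom_defect H // subrr.
Qed.
End Intertwiners.

Section Restriction.
Variables (C : numClosedFieldType) (gT : finGroupType) (G K : {group gT}).
Variables (W : hermType C) (sKG : K \subset G) (sg : urep G W).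

Definition res_urep : urep K W :=
  URep (urep1 sg) (sub_in2 (subsetP sKG) (@urepM _ _ _ _ sg))
    (sub_in1 (subsetP sKG) (@urep_unitary _ _ _ _ sg)).
End Restriction.

Section InducedSpace.
Variables (C : numClosedFieldType) (gT : finGroupType) (K : {group gT}).
Variables (V : hermType C) (th : urep K V).

Definition ind_defect (p : gT * gT) (f : {ffun gT -> V}) : V :=
  f (p.1 * p.2)%g - th (p.2^-1)%g (f p.1).

Fact ind_defect_linear p : linear (ind_defect p).
Proof.
by move=> a f1 f2; rewrite /ind_defect !ffunE linearP scalerBr opprD addrACA.
Qed.
HB.instance Definition _ p := GRing.isSemilinear.Build C {ffun gT -> V} V
  _ (ind_defect p) (GRing.semilinear_linear (ind_defect_linear p)).

Definition ind_space : {vspace {ffun gT -> V}} :=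
  (\bigcap_(p in setX [set: gT] K) lker (linfun (ind_defect p)))%VS.

Lemma ind_spaceP (f : {ffun gT -> V}) :
  reflect (forall g, {in K, forall k, f (g * k)%g = th (k^-1)%g (f g)})
          (f \in ind_space).
Proof.
rewrite memvE; apply: (iffP subv_bigcapP) => [H g k Kk|H [g k]].
  have := H (g, k); rewrite inE /= inE Kk -memvE memv_ker lfunE /= subr_eq0.
  by move=> /(_ isT) /eqP.
rewrite inE /= => /andP[_ Kk].
by rewrite -memvE memv_ker lfunE /= /ind_defect /= H // subrr.
Qed.

Definition ind := subvs_of ind_space.
HB.instance Definition _ := Vector.on ind.

Definition ind_dot (f1 f2 : ind) : C :=
  #|K|%:R^-1 * \sum_g '[vsval f1 g, vsval f2 g].

Fact ind_dot_bilinear :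
  bilinear_for (GRing.Scale.Law.clone _ _ *%R _)
    (GRing.Scale.Law.clone _ _ (conjC \; *%R) _) ind_dot.
Proof.
split=> [f2 a x y|f1 a x y]; rewrite /ind_dot /= mulrCA -mulrDr;
  congr (_ * _); rewrite mulr_sumr -big_split; apply: eq_bigr => g _ /=.
  by rewrite !ffunE dotpPl.
by rewrite !ffunE dotpPr.
Qed.
HB.instance Definition _ :=
  bilinear_isBilinear.Build C ind ind C _ _ ind_dot ind_dot_bilinear.

Fact ind_dot_herm f1 f2 : ind_dot f1 f2 = (-1) ^+ false * conjC (ind_dot f2 f1).
Proof.
rewrite expr0 mul1r rmorphM fmorphV rmorph_nat rmorph_sum; congr (_ * _).
by apply: eq_bigr => g _; rewrite dotpC.
Qed.
HB.instance Definition _ :=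
  isHermitianSesquilinear.Build C ind false conjC ind_dot ind_dot_herm.

Fact ind_dot_gt0 f : f != 0 -> 0 < ind_dot f f.
Proof.
move=> f0; rewrite mulr_gt0 ?invr_gt0 ?ltr0n ?cardG_gt0 //.
have : [exists g, vsval f g != 0].
  apply: contraR f0 => /existsPn f0; apply/eqP/val_inj/ffunP=> g.
  by rewrite ffunE; apply/eqP; rewrite -[_ == _]negbK f0.
case/existsP=> g fg; rewrite (bigD1 g) //= ltr_pwDl ?dotp_gt0 //.
by apply: sumr_ge0 => h _; exact: dotp_ge0.
Qed.
HB.instance Definition _ := isDotProduct.Build C ind ind_dot ind_dot_gt0.

HB.instance Definition _ := hasHermDot.Build C ind ind_dot.

Definition ind_trans (g0 : gT) (f : ind) : ind :=
  vsproj ind_space [ffun g => vsval f (g0^-1 * g)%g].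

Lemma ind_transE g0 f g : vsval (ind_trans g0 f) g = vsval f (g0^-1 * g)%g.
Proof.
rewrite vsprojK ?ffunE //; apply/ind_spaceP=> h k Kk; rewrite !ffunE mulgA.
exact: (ind_spaceP _ (subvsP f)).
Qed.

Fact ind_trans_linear g0 : linear (ind_trans g0).
Proof.
move=> a f1 f2; apply/val_inj/ffunP=> g.
by rewrite /= !ffunE !ind_transE /= !ffunE.
Qed.
HB.instance Definition _ g0 := GRing.isSemilinear.Build C ind ind
  _ (ind_trans g0) (GRing.semilinear_linear (ind_trans_linear g0)).

Definition ind_fun (g0 : gT) : 'End(ind) := linfun (ind_trans g0).

Fact ind_fun1 : ind_fun 1%g = \1%VF.
Proof.
apply/lfunP=> f; rewrite !lfunE; apply/val_inj/ffunP=> g.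
by rewrite ind_transE invg1 mul1g.
Qed.

Fact ind_funM : {in [set: gT] &, forall g h,
  ind_fun (g * h)%g = (ind_fun g \o ind_fun h)%VF}.
Proof.
move=> g h _ _; apply/lfunP=> f; rewrite comp_lfunE !lfunE.
by apply/val_inj/ffunP=> x; rewrite /= !ind_transE invMg mulgA.
Qed.

Fact ind_fun_unitary :
  {in [set: gT], forall g (f1 f2 : ind), '[ind_fun g f1, ind_fun g f2] = '[f1, f2]}.
Proof.
move=> g _ f1 f2; congr (_ * _); rewrite (reindex_inj (mulgI g)).
by apply: eq_bigr => x _; rewrite !lfunE /= !ind_transE mulKg.
Qed.

Definition ind_urep : urep [set: gT]%G ind :=
  URep ind_fun1 ind_funM ind_fun_unitary.

Definition ind_vec (v : V) : ind :=
  vsproj ind_space [ffun g => if g \in K then th (g^-1)%g v else 0].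

Lemma ind_vecE v g :
  vsval (ind_vec v) g = if g \in K then th (g^-1)%g v else 0.
Proof.
rewrite vsprojK ?ffunE //; apply/ind_spaceP=> h k Kk; rewrite !ffunE groupMr //.
case: ifP => [Kh|]; last by rewrite linear0.
by rewrite invMg urepM ?groupV // lfunE.
Qed.

Fact ind_vec_linear : linear ind_vec.
Proof.
move=> a u v; apply/val_inj/ffunP=> g; rewrite /= !ffunE !ind_vecE.
by case: ifP => _; rewrite ?linearP // scaler0 addr0.
Qed.
HB.instance Definition _ := GRing.isSemilinear.Build C V ind
  _ ind_vec (GRing.semilinear_linear ind_vec_linear).
End InducedSpace.

Section FrobeniusMaps.
Variables (C : numClosedFieldType) (gT : finGroupType) (K : {group gT}).
Variables (W V : hermType C) (sg : urep [set: gT]%G W) (th : urep K V).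
Local Notation s := (sqrtC #|[set: gT] : K|%g%:R : C).

Definition res_G : urep K W := res_urep (subsetT K) sg.

Definition wedge_fun (T : 'Hom(W, ind th)) (w : W) : V :=
  s *: vsval (T w) 1%g.

Fact wedge_linear T : linear (wedge_fun T).
Proof.
move=> a u v; rewrite /wedge_fun linearP /= !ffunE scalerDr.
by rewrite !scalerA mulrC.
Qed.
HB.instance Definition _ T := GRing.isSemilinear.Build C W V
  _ (wedge_fun T) (GRing.semilinear_linear (wedge_linear T)).

Definition wedge (T : 'Hom(W, ind th)) : 'Hom(W, V) := linfun (wedge_fun T).

(* The function below lies in the induced space when L intertwines the
   K-actions (see veeE); the projection vsproj only matters otherwise. *)
Definition vee_fun (L : 'Hom(W, V)) (w : W) : ind th :=
  vsproj (ind_space th) [ffun g => s^-1 *: L (sg (g^-1)%g w)].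

Fact vee_linear L : linear (vee_fun L).
Proof.
move=> a u v; rewrite /vee_fun -linearP; congr vsproj.
by apply/ffunP=> g; rewrite !ffunE !linearP.
Qed.
HB.instance Definition _ L := GRing.isSemilinear.Build C W (ind th)
  _ (vee_fun L) (GRing.semilinear_linear (vee_linear L)).

Definition vee (L : 'Hom(W, V)) : 'Hom(W, ind th) := linfun (vee_fun L).

Lemma veeE (L : 'Hom(W, V)) w g : L \in hom_rep res_G th ->
  vsval (vee L w) g = s^-1 *: L (sg (g^-1)%g w).
Proof.
move=> /hom_repP LK; rewrite lfunE vsprojK ?ffunE //.
apply/ind_spaceP=> h k Kk; rewrite !ffunE invMg urepM ?inE // lfunE /=.
rewrite linearZ /=; congr (_ *: _).
by have := LK k^-1%g; rewrite groupV => /(_ Kk) /lfunP/(_ (sg h^-1%g w));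
   rewrite !lfunE.
Qed.

Definition circ_fun (T : 'Hom(ind th, W)) (v : V) : W := s *: T (ind_vec th v).

Fact circ_linear T : linear (circ_fun T).
Proof.
by move=> a u v; rewrite /circ_fun !linearP.
Qed.
HB.instance Definition _ T := GRing.isSemilinear.Build C V W
  _ (circ_fun T) (GRing.semilinear_linear (circ_linear T)).

Definition circ (T : 'Hom(ind th, W)) : 'Hom(V, W) := linfun (circ_fun T).

(* The sum over G does not depend on a choice of coset representatives; it
   agrees with the sum over any of them by diam_transversal. *)
Definition diam_fun (L : 'Hom(V, W)) (f : ind th) : W :=
  (sqrtC (#|[set: gT]| * #|K|)%:R)^-1 *: \sum_g sg g (L (vsval f g)).

Fact diam_linear L : linear (diam_fun L).
Proof.
move=> a u v; rewrite /diam_fun scalerA mulrC -scalerA -scalerDr.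
congr (_ *: _); rewrite scaler_sumr -big_split; apply: eq_bigr => g _.
by rewrite /= !ffunE !linearP.
Qed.
HB.instance Definition _ L := GRing.isSemilinear.Build C (ind th) W
  _ (diam_fun L) (GRing.semilinear_linear (diam_linear L)).

Definition diam (L : 'Hom(V, W)) : 'Hom(ind th, W) := linfun (diam_fun L).

(* X is a set of representatives of the cosets t *: K. *)
Lemma diam_transversal (X : {set gT}) (L : 'Hom(V, W)) (f : ind th) :
    (forall g : gT, #|[set t in X | g \in (t *: K)%g]| = 1)%N ->
    L \in hom_rep th res_G ->
  diam L f = s^-1 *: \sum_(t in X) sg t (L (vsval f t)).
Proof.
move=> X1 /hom_repP LK; set F := fun g : gT => sg g (L (vsval f g)).
have FK t k : k \in K -> F (t * k)%g = F t.
  move=> Kk; rewrite /F (ind_spaceP _ _ (subvsP f)) // urepM ?inE //.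
  have /lfunP/(_ (vsval f t)) := LK _ (groupVr Kk); rewrite !lfunE /= => ->.
  rewrite -[sg k _]comp_lfunE -urepM ?inE // mulgV urep1.
  by rewrite lfunE.
have FS : \sum_g F g = #|K|%:R *: \sum_(t in X) F t.
  transitivity (\sum_g \sum_(t in X | g \in (t *: K)%g) F g).
    apply: eq_bigr => g _; rewrite sumr_const -[LHS]mulr1n -(X1 g).
    by congr (_ *+ _); apply: eq_card => t; rewrite !inE.
  rewrite (exchange_big_dep (mem X)) /=; last by move=> g t _ /andP[].
  rewrite scaler_sumr; apply: eq_bigr => t Xt; rewrite Xt /=.
  rewrite (reindex_inj (mulgI t)) /=.
  rewrite (eq_bigl (mem K)); last by move=> k; rewrite /= mem_lcoset mulKg.
  by rewrite (eq_bigr (fun=> F t)) ?sumr_const ?scaler_nat // => k; exact: FK.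
rewrite lfunE /= /diam_fun FS scalerA; congr (_ *: _).
have K0 : (#|K|%:R : C) != 0 by rewrite pnatr_eq0 -lt0n cardG_gt0.
rewrite -(Lagrange (subsetT K)) mulnAC natrM sqrtCM ?nnegrE ?ler0n //.
by rewrite natrM -expr2 sqrCK ?ler0n // invfM mulrAC mulVf ?mul1r.
Qed.

End FrobeniusMaps.

(* Main.v *)
(* Let J : V -> Ind V be v |-> f_v; its adjoint is evaluation at 1, and
   J^* J = 1.  Then T^o = s T J and T^wedge = s J^* T with s = sqrt |G/K|,
   which gives the commutative square at once.  The translates of J resolve the
   identity: \sum_g lambda(g) J J^* lambda(g)^-1 = |K|.  Hence T is recovered
   from T J, and, taking traces, tr S = |G/K| tr (J^* S J) for every
   G-endomorphism S of Ind V.  With S = 1 this gives dim Ind V = |G/K| dim V,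
   with S = T2^* T1 the isometry. *)
Require Import Defs.
From mathcomp Require Import all_boot all_order all_algebra all_fingroup.
From mathcomp Require Import reals complex.

Set Implicit Arguments.
Unset Strict Implicit.
Unset Printing Implicit Defensive.

Import GRing.Theory Num.Theory.
Local Open Scope ring_scope.

(** * Linearity and cyclicity of the trace *)

Section Trace.
Variables (F : fieldType) (U1 U2 : vectType F).

Lemma lfun_trP a (f g : 'End(U1)) :
  lfun_tr (a *: f + g) = a * lfun_tr f + lfun_tr g.
Proof. by rewrite /lfun_tr passmx.mxof_linear mxtraceD mxtraceZ. Qed.

Lemma lfun_tr0 : lfun_tr (0 : 'End(U1)) = 0.
Proof.
by have := lfun_trP (-1) 0 0; rewrite scaler0 addr0 mulN1r addNr.
Qed.

Lemma lfun_trZ a (f : 'End(U1)) : lfun_tr (a *: f) = a * lfun_tr f.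
Proof. by rewrite -[a *: f]addr0 lfun_trP lfun_tr0 addr0. Qed.

Lemma lfun_tr_sum I (r : seq I) (P : pred I) (f : I -> 'End(U1)) :
  lfun_tr (\sum_(i <- r | P i) f i) = \sum_(i <- r | P i) lfun_tr (f i).
Proof.
apply: (big_morph (@lfun_tr F U1)) => [f1 f2|]; last exact: lfun_tr0.
by rewrite -[f1]scale1r lfun_trP mul1r scale1r.
Qed.

(** Allowing two spaces lets a trace on [V] be compared with one on [ind th]. *)
Lemma lfun_trC (f : 'Hom(U1, U2)) (g : 'Hom(U2, U1)) :
  lfun_tr (g \o f)%VF = lfun_tr (f \o g)%VF.
Proof.
rewrite /lfun_tr (passmx.mxof_comp _ _ (vbasisP {:U2})).
by rewrite (passmx.mxof_comp _ _ (vbasisP {:U1})) mxtrace_mulC.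
Qed.

Lemma lfun_tr1 : lfun_tr (\1%VF : 'End(U1)) = (\dim {:U1})%:R.
Proof.
by rewrite /lfun_tr passmx.mxof1 ?mxtrace1 // (basis_free (vbasisP _)).
Qed.
End Trace.

(** * Calculus of adjoints *)

Lemma dotp_extr (C : numClosedFieldType) (A : hermType C) (u v : A) :
  (forall a, '[a, u] = '[a, v]) -> u = v.
Proof.
move=> uv; apply/eqP; rewrite -subr_eq0 -dotp_eq0.
by rewrite dotpBr uv subrr.
Qed.

Section AdjointTheory.
Variables (C : numClosedFieldType) (A B D : hermType C).

Lemma dotp_adjl (T : 'Hom(A, B)) a b : '[lfun_adj T b, a] = '[b, T a].
Proof. by rewrite dotpC -lfun_adjP -dotpC. Qed.

Lemma lfun_adjK (T : 'Hom(A, B)) : lfun_adj (lfun_adj T) = T.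
Proof. by apply/esym/lfun_adj_uniq => b a; exact: dotp_adjl. Qed.

Lemma lfun_adj_comp (S : 'Hom(B, D)) (T : 'Hom(A, B)) :
  lfun_adj (S \o T)%VF = (lfun_adj T \o lfun_adj S)%VF.
Proof. by apply/esym/lfun_adj_uniq => a d; rewrite !comp_lfunE !lfun_adjP. Qed.

Lemma lfun_adjZ c (T : 'Hom(A, B)) : lfun_adj (c *: T) = c^* *: lfun_adj T.
Proof.
apply/esym/lfun_adj_uniq => a b.
by rewrite !scale_lfunE dotpZl lfun_adjP dotpZr conjCK.
Qed.
End AdjointTheory.

(** * Unitary representations and adjoints of intertwiners *)

Section UnitaryRep.
Variables (C : numClosedFieldType) (gT : finGroupType) (G : {group gT}).
Variables (A : hermType C) (rA : urep G A).

Lemma urepVK g v : g \in G -> rA g (rA g^-1%g v) = v.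
Proof.
by move=> Gg; rewrite -comp_lfunE -urepM ?groupV // mulgV urep1 lfunE.
Qed.

Lemma urep_adj g : g \in G -> lfun_adj (rA g) = rA g^-1%g.
Proof.
move=> Gg; apply/esym/lfun_adj_uniq => a b.
by rewrite -{1}(urepVK b Gg) urep_unitary.
Qed.

End UnitaryRep.

(** By unitarity, the adjoint of the intertwining relation at [g^-1] is the relation at [g]. *)
Lemma hom_rep_adj (C : numClosedFieldType) (gT : finGroupType) (G : {group gT})
    (A B : hermType C) (rA : urep G A) (rB : urep G B) (T : 'Hom(A, B)) :
  T \in hom_rep rA rB -> lfun_adj T \in hom_rep rB rA.
Proof.
move=> /hom_repP TG; apply/hom_repP => g Gg.
have GVg : g^-1%g \in G by rewrite groupV.
have := congr1 (@lfun_adj _ _ _) (TG _ GVg).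
by rewrite !lfun_adj_comp !urep_adj // invgK => ->.
Qed.

(** * The embedding [J] and traces on the induced space *)

Section Induced.
Variables (C : numClosedFieldType) (gT : finGroupType) (K : {group gT}).
Variables (V : hermType C) (th : urep K V).
Local Notation J := (linfun (ind_vec th)).

Lemma ind_urepE g (h : ind th) x :
  vsval (ind_urep th g h) x = vsval h (g^-1 * x)%g.
Proof. by rewrite /= lfunE /= ind_transE. Qed.

Lemma dotp_indE (f h : ind th) :
  '[f, h] = #|K|%:R^-1 * \sum_g '[vsval f g, vsval h g].
Proof. by []. Qed.

Lemma cardK_neq0 : (#|K|%:R : C) != 0.
Proof. by rewrite pnatr_eq0 -lt0n cardG_gt0. Qed.

(** This equivariance of [J] under [K] is what makes [circ T] a [K]-intertwiner. *)
Lemma ind_vec_urep k v :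
  k \in K -> ind_vec th (th k v) = ind_urep th k (ind_vec th v).
Proof.
move=> Kk; apply/val_inj/ffunP => x /=.
rewrite ind_urepE !ind_vecE groupMl ?groupV //; case: ifP => // Kx.
by rewrite invMg invgK urepM ?groupV // comp_lfunE.
Qed.

(** Since [f_v] is supported on [K], where [f_v] and [h] are both moved by the unitary [th g^-1]
    from their values at 1, the scalar product has [#|K|] equal terms, which cancel its
    normalization. *)
Lemma ind_vec_adj (h : ind th) : lfun_adj J h = vsval h 1%g.
Proof.
apply: dotp_extr => v; rewrite -lfun_adjP lfunE /=.
rewrite dotp_indE (bigID (mem K)) /= [X in _ + X]big1 ?addr0; last first.
  by move=> g /negPf nKg; rewrite ind_vecE nKg /dotp linear0l.
rewrite (eq_bigr (fun=> '[v, vsval h 1%g])) => [|g Kg].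
  by rewrite sumr_const -[X in _ * X]mulr_natl mulKf ?cardK_neq0.
have hg : vsval h g = th g^-1%g (vsval h 1%g).
  by rewrite -[g in LHS]mul1g (ind_spaceP _ _ (subvsP h)).
by rewrite ind_vecE Kg hg urep_unitary ?groupV.
Qed.

Lemma ind_vec_adjK : (lfun_adj J \o J)%VF = \1%VF.
Proof.
apply/lfunP => v; rewrite comp_lfunE ind_vec_adj !lfunE /= ind_vecE group1.
by rewrite invg1 urep1 lfunE.
Qed.

(** The resolution of the identity, with [J^* lambda(g)^-1 h] evaluated as [h g]. At [x] only the
    [#|K|] terms with [g] in [xK] survive, and each equals [h x]. *)
Lemma ind_resolution (h : ind th) :
  \sum_g ind_urep th g (ind_vec th (vsval h g)) = #|K|%:R *: h.
Proof.
apply/val_inj/ffunP => x.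
rewrite linear_sum linearZ /= sum_ffunE ffunE.
(* Substituting [g = x k^-1] makes [g^-1 x = k], the point where [f_(h g)] is evaluated. *)
rewrite (reindex_inj (inj_comp (mulgI x) invg_inj)) /= (bigID (mem K)) /=.
rewrite [X in _ + X]big1 ?addr0 => [|k /negPf nKk].
  rewrite (eq_bigr (fun=> vsval h x)) ?sumr_const ?scaler_nat // => k Kk.
  rewrite ind_urepE ind_vecE invMg invgK -mulgA mulVg mulg1 Kk.
  by rewrite (ind_spaceP _ _ (subvsP h)) ?groupV ?urepVK ?groupV.
by rewrite ind_urepE ind_vecE invMg invgK -mulgA mulVg mulg1 nKk.
Qed.

Lemma lfun_tr_ind (S : 'End(ind th)) :
    S \in hom_rep (ind_urep th) (ind_urep th) ->
  lfun_tr S = #|[set: gT] : K|%g%:R * lfun_tr (lfun_adj J \o (S \o J))%VF.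
Proof.
move=> /hom_repP SG; apply: (mulfI cardK_neq0).
rewrite mulrA -natrM (Lagrange (subsetT K)) -lfun_trZ.
have -> : #|K|%:R *: S = \sum_g (ind_urep th g \o
    ((S \o J) \o (lfun_adj J \o ind_urep th g^-1%g)))%VF.
  apply/lfunP => h; rewrite scale_lfunE -linearZ -ind_resolution sum_lfunE.
  rewrite linear_sum; apply: eq_bigr => g _.
  (* Commuting [S] past the translation by [g] makes each summand a conjugate of [S J J^*]. *)
  rewrite -[LHS](comp_lfunE S (ind_urep th g)) SG ?inE // !comp_lfunE.
  by rewrite ind_vec_adj ind_urepE invgK mulg1 (lfunE (ind_vec th)).
rewrite lfun_tr_sum (eq_bigr (fun=> lfun_tr (lfun_adj J \o (S \o J))%VF)).
  by rewrite sumr_const mulr_natl cardsT.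
(* Cyclicity turns both sides into the trace of [S J J^*] on [ind th], where [g^-1] meets [g]. *)
move=> g _; rewrite lfun_trC [RHS]lfun_trC -!comp_lfunA -urepM ?inE //.
by rewrite mulVg urep1 comp_lfun1r.
Qed.

Lemma dim_ind : \dim {:ind th} = (#|[set: gT] : K|%g * \dim {:V})%N.
Proof.
(* The dimensions are compared in [C], as traces of identities. *)
apply/eqP; rewrite -(eqr_nat C) natrM -!lfun_tr1 lfun_tr_ind.
  by rewrite comp_lfun1l ind_vec_adjK.
by apply/hom_repP => g _; rewrite comp_lfun1l comp_lfun1r.
Qed.
End Induced.

(** * The Frobenius maps, their inverses and adjoints *)

Section Frobenius.
Variables (C : numClosedFieldType) (gT : finGroupType) (K : {group gT}).
Variables (W V : hermType C) (sg : urep [set: gT]%G W) (th : urep K V).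
Local Notation J := (linfun (ind_vec th)).
Local Notation n := (#|[set: gT] : K|%g).
Local Notation s := (sqrtC n%:R : C).
Local Notation c := (sqrtC (#|[set: gT]| * #|K|)%:R : C).

Lemma circE (T : 'Hom(ind th, W)) : circ T = s *: (T \o J)%VF.
Proof.
by apply/lfunP => v; rewrite lfunE scale_lfunE comp_lfunE lfunE.
Qed.

Lemma wedgeE (T : 'Hom(W, ind th)) : wedge T = s *: (lfun_adj J \o T)%VF.
Proof.
by apply/lfunP => w; rewrite lfunE scale_lfunE comp_lfunE ind_vec_adj.
Qed.

Lemma conj_sqrt_index : s^* = s.
Proof. by apply/geC0_conj; rewrite sqrtC_ge0 ler0n. Qed.

Lemma index_neq0 : (n%:R : C) != 0.
Proof. by rewrite pnatr_eq0 -lt0n indexg_gt0. Qed.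

Lemma sqrt_index_neq0 : s != 0.
Proof. by rewrite sqrtC_eq0 index_neq0. Qed.

(** From [|G| |K| = |K|^2 |G/K|]. The constant of [diam] thus absorbs both the [#|K|] equal terms of
    a coset and the factor [s] of [circ]. *)
Lemma sqrt_orderE : c = #|K|%:R * s.
Proof.
rewrite -(Lagrange (subsetT K)) mulnAC natrM sqrtCM ?nnegrE ?ler0n //.
by rewrite natrM -expr2 sqrCK ?ler0n.
Qed.

Lemma sqrt_order_neq0 : c != 0.
Proof. by rewrite sqrt_orderE mulf_neq0 ?cardK_neq0 ?sqrt_index_neq0. Qed.

Lemma circ_hom (T : 'Hom(ind th, W)) :
  T \in hom_rep (ind_urep th) sg -> circ T \in hom_rep th (res_G K sg).
Proof.
move=> /hom_repP TG; apply/hom_repP => k Kk; apply/lfunP => v.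
rewrite !comp_lfunE circE !scale_lfunE !comp_lfunE !lfunE /= linearZ.
by rewrite ind_vec_urep // -[T _]comp_lfunE TG ?inE // comp_lfunE.
Qed.

Lemma diamE (L : 'Hom(V, W)) (f : ind th) :
  diam sg th L f = c^-1 *: \sum_g sg g (L (vsval f g)).
Proof. by rewrite lfunE. Qed.

(** A translation of the argument is absorbed by reindexing the sum over the group. *)
Lemma diam_hom (L : 'Hom(V, W)) : diam sg th L \in hom_rep (ind_urep th) sg.
Proof.
apply/hom_repP => g _; apply/lfunP => f.
rewrite !comp_lfunE !diamE linearZ; congr (_ *: _).
rewrite linear_sum (reindex_inj (mulgI g)); apply: eq_bigr => x _.
by rewrite ind_urepE mulKg urepM ?inE // comp_lfunE.
Qed.

(** Equivariance rewrites each summand as [T] applied to a term of [ind_resolution]. *)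
Lemma circK (T : 'Hom(ind th, W)) :
  T \in hom_rep (ind_urep th) sg -> diam sg th (circ T) = T.
Proof.
move=> /hom_repP TG; apply/lfunP => f; rewrite diamE.
rewrite (eq_bigr (fun g => s *: T (ind_urep th g (ind_vec th (vsval f g))))).
  rewrite -scaler_sumr -linear_sum ind_resolution.
  rewrite [X in _ *: (_ *: X)]linearZ /= !scalerA -mulrA [s * _]mulrC.
  by rewrite -sqrt_orderE mulVf ?scale1r ?sqrt_order_neq0.
move=> g _; rewrite circE scale_lfunE comp_lfunE (lfunE (ind_vec th)) linearZ.
by congr (_ *: _); rewrite -[RHS](comp_lfunE T) TG ?inE // comp_lfunE.
Qed.

(** On [f_v] only [g] in [K] contributes, and there [sg g] undoes the [th g^-1] that [L] carries
    across, leaving [L v]. *)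
Lemma diamK (L : 'Hom(V, W)) :
  L \in hom_rep th (res_G K sg) -> circ (diam sg th L) = L.
Proof.
move=> /hom_repP LK; apply/lfunP => v.
rewrite circE scale_lfunE comp_lfunE (lfunE (ind_vec th)) diamE.
rewrite (bigID (mem K)) /=.
rewrite [X in _ + X]big1 ?addr0 => [|g /negPf nKg]; last first.
  by rewrite ind_vecE nKg !linear0.
rewrite (eq_bigr (fun=> L v)) => [|g Kg].
  rewrite sumr_const -scaler_nat !scalerA mulrAC [s * _]mulrC -sqrt_orderE.
  by rewrite mulfV ?scale1r ?sqrt_order_neq0.
rewrite ind_vecE Kg -[L (_ v)]comp_lfunE LK ?groupV // comp_lfunE /=.
by rewrite urepVK ?inE.
Qed.

Lemma vee_adj (L : 'Hom(V, W)) :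
    L \in hom_rep th (res_G K sg) ->
  vee sg th (lfun_adj L) = lfun_adj (diam sg th L).
Proof.
move=> /hom_rep_adj LK; apply: lfun_adj_uniq => f w.
(* Of [c^-1 = #|K|^-1 s^-1], the first factor normalizes the product on [ind th] and the second
   belongs to [vee]; the sums then agree term by term. *)
rewrite diamE dotpZl dotp_suml dotp_indE sqrt_orderE invfM -mulrA.
congr (_ * _); rewrite mulr_sumr; apply: eq_bigr => g _.
rewrite veeE // dotpZr fmorphV /= conj_sqrt_index -lfun_adjP.
by rewrite -urep_adj ?inE // -lfun_adjP.
Qed.

Lemma circ_adj (T : 'Hom(W, ind th)) : circ (lfun_adj T) = lfun_adj (wedge T).
Proof.
by rewrite circE wedgeE lfun_adjZ lfun_adj_comp lfun_adjK conj_sqrt_index.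
Qed.

(** Obtained by going around the square: [wedge T] is the adjoint of [circ (lfun_adj T)]. *)
Lemma wedge_hom (T : 'Hom(W, ind th)) :
  T \in hom_rep sg (ind_urep th) -> wedge T \in hom_rep (res_G K sg) th.
Proof.
move=> /hom_rep_adj /circ_hom /hom_rep_adj.
by rewrite circ_adj lfun_adjK.
Qed.

Lemma hs_dot_circ (T1 T2 : 'Hom(ind th, W)) :
    T1 \in hom_rep (ind_urep th) sg -> T2 \in hom_rep (ind_urep th) sg ->
  hs_dot (circ T1) (circ T2) = n%:R * hs_dot T1 T2.
Proof.
(* On the right, [n] cancels against the dimension of [ind th] and reappears from the trace formula;
   on the left it is [s^2]. *)
move=> T1G /hom_rep_adj T2G; rewrite /hs_dot dim_ind natrM invfM !mulrA.
rewrite mulfV ?index_neq0 // mul1r lfun_tr_ind; last first.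
  apply/hom_repP => g Gg; rewrite -comp_lfunA (hom_repP _ _ _ T1G) //.
  by rewrite comp_lfunA (hom_repP _ _ _ T2G) // comp_lfunA.
rewrite !circE lfun_adjZ lfun_adj_comp conj_sqrt_index.
rewrite -comp_lfunZl -comp_lfunZr !lfun_trZ mulrA -expr2 sqrtCK.
by rewrite !comp_lfunA.
Qed.
End Frobenius.

Theorem corollary3p3 (R : realType) (gT : finGroupType) (K : {group gT})
    (W V : hermType R[i]) (sg : urep [set: gT]%G W) (th : urep K V) :
  let Hom_G_WI := hom_rep sg (ind_urep th) in
  let Hom_G_IW := hom_rep (ind_urep th) sg in
  let Hom_K_WV := hom_rep (res_G K sg) th in
  let Hom_K_VW := hom_rep th (res_G K sg) in
  [/\ linear_iso Hom_G_IW Hom_K_VW (@circ _ _ _ W V th),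
      {in Hom_G_IW &, forall T1 T2,
        hs_dot (circ T1) (circ T2) = #|[set: gT] : K|%g%:R * hs_dot T1 T2},
      [/\ {in Hom_K_VW, forall L, diam sg th L \in Hom_G_IW},
          {in Hom_G_IW, forall T, diam sg th (circ T) = T}
        & {in Hom_K_VW, forall L, circ (diam sg th L) = L}],
      {in Hom_K_VW, forall L, vee sg th (lfun_adj L) = lfun_adj (diam sg th L)}
    & [/\ {in Hom_G_WI, forall T, wedge T \in Hom_K_WV},
          {in Hom_G_WI, forall T, lfun_adj T \in Hom_G_IW},
          {in Hom_K_WV, forall L, lfun_adj L \in Hom_K_VW}
        & {in Hom_G_WI, forall T, circ (lfun_adj T) = lfun_adj (wedge T)}]].
Proof.
split.
- split=> [T|S T _ _ a|S T SG TG ST|L LK].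
  + exact: circ_hom.
  + by rewrite !circE comp_lfunDl -comp_lfunZl scalerDr !scalerA mulrC.
  + by rewrite -(circK SG) ST circK.
  + by exists (diam sg th L); [exact: diam_hom | exact: diamK].
- by move=> T1 T2; exact: hs_dot_circ.
- by split=> [L _|T|L]; [exact: diam_hom | exact: circK | exact: diamK].
- by move=> L; exact: vee_adj.
split=> [T|T|L|T _]; [exact: wedge_hom | exact: hom_rep_adj | | ].
  exact: hom_rep_adj.
exact: circ_adj.
Qed.
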